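(* The upper bound $10$ on the number of real zeros of nonnegative biquadratic forms on $\mathbb{P}^2\times\mathbb{P}^2$ with finitely many real zeros is attained: there exists a nonnegative biquadratic form $p(x,y)$, $x=(x_0,x_1,x_2)$, $y=(y_0,y_1,y_2)$, having exactly $10$ zeros in $\mathbb{P}^2(\mathbb{R})\times\mathbb{P}^2(\mathbb{R})$.
   Context: A biquadratic form on $\mathbb{P}^2\times\mathbb{P}^2$ is a real polynomial $p(x,y)$ in $x=(x_0,x_1,x_2)$ and $y=(y_0,y_1,y_2)$ that is homogeneous of degree 2 in $x$ and homogeneous of degree 2 in $y$. It is nonnegative if $p(x,y)\ge 0$ for all $x,y\in\mathbb{R}^3$. Its real zeros are the points $(x;y)\in\mathbb{P}^2(\mathbb{R})\times\mathbb{P}^2(\mathbb{R})$ with $p(x,y)=0$. It is a known result (Quarez) that a nonnegative biquadratic form on $\mathbb{P}^2\times\mathbb{P}^2$ with finitely many real zeros has at most 10 real zeros. *)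

(* Defs.v *)
From HB Require Import structures.
From mathcomp Require Export all_boot all_order all_algebra.
From mathcomp Require Export mpoly.
From mathcomp Require Export classical_sets cardinality reals.

Set Implicit Arguments.
Unset Strict Implicit.
Unset Printing Implicit Defensive.

Import GRing.Theory.

Local Open Scope ring_scope.

(* P^n(F): the lines through the origin of F^(n+1). *)
Definition proj_space (F : fieldType) (n : nat) :=
  {L : {vspace 'rV[F]_n.+1} | \dim L == 1%N}.

(* The variables are numbered with x_i = 'X_(lshift 3 i) and
   y_j = 'X_(rshift 3 j). *)
Definition xdeg (m : 'X_{1..3 + 3}) : nat := \sum_(i < 3) m (lshift 3 i).
Definition ydeg (m : 'X_{1..3 + 3}) : nat := \sum_(j < 3) m (rshift 3 j).

Definition biquadratic_form (R : nzRingType) (p : {mpoly R[3 + 3]}) : Prop :=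
  forall m, m \in msupp p -> xdeg m = 2%N /\ ydeg m = 2%N.

Definition bieval (R : nzRingType) (p : {mpoly R[3 + 3]})
    (x y : 'rV[R]_3) : R :=
  p.@[fun k => row_mx x y 0 k].

Definition nonnegative_form (R : realType) (p : {mpoly R[3 + 3]}) : Prop :=
  forall x y : 'rV[R]_3, 0 <= bieval p x y.

(* Quantifying over all representatives avoids choosing homogeneous
   coordinates; by [bizeroE] below, testing one nonzero pair is the same. *)
Definition bizero (R : fieldType) (p : {mpoly R[3 + 3]})
    (z : proj_space R 2 * proj_space R 2) : Prop :=
  forall x y : 'rV[R]_3,
    x \in val z.1 -> y \in val z.2 -> bieval p x y = 0.

Definition bizeros (R : fieldType) (p : {mpoly R[3 + 3]}) :
    set (proj_space R 2 * proj_space R 2) :=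
  [set z | bizero p z]%classic.

Lemma dim_proj_pt (F : fieldType) (n : nat) (x : 'rV[F]_n.+1) :
  x != 0 -> \dim <[x]>%VS == 1%N.
Proof. by move=> x0; rewrite dim_vline x0. Qed.

Definition proj_pt (F : fieldType) (n : nat) (x : 'rV[F]_n.+1) (x0 : x != 0) :
  proj_space F n := exist _ <[x]>%VS (dim_proj_pt x0).

Lemma proj_ptP (F : fieldType) (n : nat) (L : proj_space F n) :
  exists (x : 'rV[F]_n.+1) (x0 : x != 0), L = proj_pt x0.
Proof.
case: L => L dL.
have L0 : L != 0%VS by rewrite -dimv_eq0 (eqP dL).
have x0 : vpick L != 0 by rewrite vpick0.
exists (vpick L), x0; apply: val_inj => /=; apply/esym/eqP.
by rewrite eqEdim -memvE memv_pick dim_vline x0 (eqP dL).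
Qed.

Lemma proj_pt_eq (F : fieldType) (n : nat) (x y : 'rV[F]_n.+1)
    (x0 : x != 0) (y0 : y != 0) :
  proj_pt x0 = proj_pt y0 <-> exists2 c : F, c != 0 & x = c *: y.
Proof.
split=> [/(congr1 val)/= exy|[c c0 exy]].
  have /vlineP[c xE] : x \in <[y]>%VS by rewrite -exy memv_line.
  exists c => //; apply: contraNneq x0 => c0.
  by rewrite xE c0 scale0r.
apply: val_inj => /=; apply/eqP.
rewrite eqEdim !dim_vline x0 y0 andbT -memvE exy.
exact/memvZ/memv_line.
Qed.

Lemma bievalZ (R : comNzRingType) (p : {mpoly R[3 + 3]}) (a b : R)
    (x y : 'rV[R]_3) :
  biquadratic_form p ->
  bieval p (a *: x) (b *: y) = a ^+ 2 * b ^+ 2 * bieval p x y.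
Proof.
move=> hp; rewrite /bieval !mevalE mulr_sumr !big_seq.
apply: eq_bigr => m /hp[dx dy].
rewrite !(big_split_ord (idx := 1)) /= [RHS]mulrCA; congr (_ * _).
under eq_bigr => i _ do rewrite row_mxEl mxE exprMn.
under [X in _ * X = _]eq_bigr => i _ do rewrite row_mxEr mxE exprMn.
under [in RHS]eq_bigr => i _ do rewrite row_mxEl.
under [X in _ = _ * (_ * X)]eq_bigr => i _ do rewrite row_mxEr.
by rewrite !big_split /= !prodrXr -/(xdeg m) -/(ydeg m) dx dy mulrACA.
Qed.

Lemma bizeroE (R : fieldType) (p : {mpoly R[3 + 3]}) (x y : 'rV[R]_3)
    (x0 : x != 0) (y0 : y != 0) :
  biquadratic_form p ->
  bizero p (proj_pt x0, proj_pt y0) <-> bieval p x y = 0.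
Proof.
move=> hp; split=> [|pxy]; first by apply; exact: memv_line.
by move=> _ _ /vlineP[a ->] /vlineP[b ->]; rewrite bievalZ // pxy mulr0.
Qed.

(* Main.v *)
Require Import Defs.
From mathcomp Require Import ring lra.

(** Ten zeros are attained by a generalised Choi form: with indices modulo 3,
[[
  p(x, y) = sum_i (9 x_i^2 + x_(i+1)^2 + 16 x_(i+2)^2) y_i^2
            - 26 sum_i x_i x_(i+1) y_i y_(i+1).
]]
    It is the member t = 2 of the family with coefficients (t^2 - 1)^2, 1, t^4
    and -2 (t^4 - t^2 + 1); an integral t makes every zero rational.

    For fixed x, set a_i = 22 x_i^2 + x_(i+1)^2 + 16 x_(i+2)^2.  Then
    p(x, y) = sum_i a_i y_i^2 - 13 (sum_i x_i y_i)^2, so by Cauchy-Schwarz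
    p(x, .) is nonnegative as soon as 13 sum_i x_i^2 / a_i <= 1.  Clearing
    denominators, and keeping the Lagrange remainder of Cauchy-Schwarz, gives
    the identity [choi_lagrange]
[[
  a_0 a_1 a_2 p = 9 gap(x_0^2, x_1^2, x_2^2) (sum_i a_i y_i^2)
                  + 13 (a combination with weights a_k of squared minors)
]]
    where gap is a cyclically symmetric ternary cubic.  Everything reduces to
    the sign of gap on the nonnegative octant.  By cyclic symmetry the first
    coordinate may be assumed minimal, and [gapE] then displays gap as a sum of
    two nonnegative terms, which vanish together only on the ray of (1, 1, 1)
    and, up to rotation, on the ray of (0, 1, 4).

    At a zero of p both summands of the identity vanish.  The first restricts
    the squares of the x_i to these rays, so x is one of (1, +-1, +-1) or a
    rotation of (0, 1, +-2); the vanishing minors, which are the equality case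
    of Cauchy-Schwarz, then determine y up to a scalar ([choi_zero_inv]).  This
    gives 4 + 3 * 2 = 10 zeros, told apart by their first component
    ([zero_x_inj]). *)

Set Implicit Arguments.
Unset Strict Implicit.
Unset Printing Implicit Defensive.

Import Order.TTheory GRing.Theory Num.Theory.

Local Open Scope ring_scope.

(** * The form as a function of six scalars *)

Definition choi (S : comNzRingType) (x0 x1 x2 y0 y1 y2 : S) : S :=
  (9 * x0 ^+ 2 * y0 ^+ 2 + x1 ^+ 2 * y0 ^+ 2 + 16 * x2 ^+ 2 * y0 ^+ 2
     - 26 * x0 * x1 * y0 * y1)
  + (9 * x1 ^+ 2 * y1 ^+ 2 + x2 ^+ 2 * y1 ^+ 2 + 16 * x0 ^+ 2 * y1 ^+ 2
     - 26 * x1 * x2 * y1 * y2)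
  + (9 * x2 ^+ 2 * y2 ^+ 2 + x0 ^+ 2 * y2 ^+ 2 + 16 * x1 ^+ 2 * y2 ^+ 2
     - 26 * x2 * x0 * y2 * y0).

Lemma choi_rot (S : comNzRingType) (x0 x1 x2 y0 y1 y2 : S) :
  choi x1 x2 x0 y1 y2 y0 = choi x0 x1 x2 y0 y1 y2.
Proof. by rewrite /choi; ring. Qed.

Lemma rmorph_choi (S T : comNzRingType) (f : {rmorphism S -> T})
    x0 x1 x2 y0 y1 y2 :
  f (choi x0 x1 x2 y0 y1 y2) = choi (f x0) (f x1) (f x2) (f y0) (f y1) (f y2).
Proof.
by rewrite /choi !expr2 !rmorphD !rmorphN !rmorphM !rmorph_nat.
Qed.

Section Choi.
Variable R : realFieldType.
Implicit Types x y u s t : R.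

(** A diagonal entry of the Gram matrix of the form in y once
    [13 * (x0 * y0 + x1 * y1 + x2 * y2) ^+ 2] has been added to it: the
    constant 22 is 9 + 13. *)
Definition weight x0 x1 x2 : R := 22 * x0 ^+ 2 + x1 ^+ 2 + 16 * x2 ^+ 2.

(** Nine times this cubic, at the squares of the [x_i], is the determinant of
    the Gram matrix of the form in y.  It is evaluated at the squares because
    its nonnegativity holds on the octant only. *)
Definition gap u0 u1 u2 : R :=
  16 * (u0 ^+ 3 + u1 ^+ 3 + u2 ^+ 3)
  + 248 * (u0 ^+ 2 * u1 + u1 ^+ 2 * u2 + u2 ^+ 2 * u0)
  - 127 * (u0 * u1 ^+ 2 + u1 * u2 ^+ 2 + u2 * u0 ^+ 2)
  - 411 * (u0 * u1 * u2).

(** Lagrange's identity for the vectors of entries [sqrt a_i * y_i] and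
    [x_i / sqrt a_i], multiplied by [a0 * a1 * a2] so that neither roots nor
    quotients remain. *)
Lemma choi_lagrange x0 x1 x2 y0 y1 y2 :
  let a0 := weight x0 x1 x2 in
  let a1 := weight x1 x2 x0 in
  let a2 := weight x2 x0 x1 in
  a0 * a1 * a2 * choi x0 x1 x2 y0 y1 y2 =
  9 * gap (x0 ^+ 2) (x1 ^+ 2) (x2 ^+ 2)
    * (a0 * y0 ^+ 2 + a1 * y1 ^+ 2 + a2 * y2 ^+ 2)
  + 13 * (a2 * (a0 * y0 * x1 - a1 * y1 * x0) ^+ 2
          + a0 * (a1 * y1 * x2 - a2 * y2 * x1) ^+ 2
          + a1 * (a2 * y2 * x0 - a0 * y0 * x2) ^+ 2).
Proof. by rewrite /= /weight /gap /choi; ring. Qed.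

(** Substituting the excesses over the first coordinate kills the terms in
    [u ^+ 3] and [u ^+ 2], because (1, 1, 1) is a double zero of the cubic.  The
    last summand is the value on the edge [u = 0], with its double zero at
    (0, 1, 4). *)
Lemma gapE u s t :
  gap u (u + s) (u + t) =
  169 * u * (s ^+ 2 - s * t + t ^+ 2) + (t - 4 * s) ^+ 2 * (16 * t + s).
Proof. by rewrite /gap; ring. Qed.

Lemma gap_ge0 u0 u1 u2 : 0 <= u0 -> u0 <= u1 -> u0 <= u2 -> 0 <= gap u0 u1 u2.
Proof.
move=> u0_ge0 u01 u02.
rewrite -(subrKC u0 u1) -(subrKC u0 u2) gapE.
have := sqr_ge0 (u1 - u0 - (u2 - u0)) => ?.
rewrite addr_ge0 // mulr_ge0 ?sqr_ge0 //; [lra|nra|lra].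
Qed.

Lemma gap_eq0 u0 u1 u2 : 0 <= u0 -> u0 <= u1 -> u0 <= u2 -> gap u0 u1 u2 = 0 ->
  (u1 = u0 /\ u2 = u0) \/ (u0 = 0 /\ u2 = 4 * u1).
Proof.
move=> u0_ge0 u01 u02.
have [s [s0 ->]] : exists s, 0 <= s /\ u1 = u0 + s by exists (u1 - u0); lra.
have [t [t0 ->]] : exists t, 0 <= t /\ u2 = u0 + t by exists (u2 - u0); lra.
rewrite gapE => /eqP.
have q_ge0 : 0 <= s ^+ 2 - s * t + t ^+ 2 by have := sqr_ge0 (s - t); nra.
rewrite paddr_eq0; last 2 first.
- by rewrite mulr_ge0 //; lra.
- by rewrite mulr_ge0 ?sqr_ge0 //; lra.
have [st0|st0] := eqVneq (s + t) 0; first by left; lra.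
have c0 : 16 * t + s != 0 by apply: contra_neq st0; lra.
rewrite [X in _ && X]mulf_eq0 (negPf c0) orbF expf_eq0 /= subr_eq0.
case/andP => /[swap] /eqP ->.
rewrite mulf_eq0 => /orP[/eqP u00|/eqP q0]; first by right; lra.
have : s ^+ 2 = 0 by lra.
by move/eqP; rewrite expf_eq0 /= => /eqP ->; left; lra.
Qed.

Lemma weight_gt0 x0 x1 x2 :
  ~~ [&& x0 == 0, x1 == 0 & x2 == 0] -> 0 < weight x0 x1 x2.
Proof.
have := sqr_ge0 x0; have := sqr_ge0 x1; have := sqr_ge0 x2.
rewrite -[x0 == 0]sqrf_eq0 -[x1 == 0]sqrf_eq0 -[x2 == 0]sqrf_eq0.
rewrite /weight => p2 p1 p0; apply: contraNT; rewrite -leNgt => w_le0.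
by apply/and3P; split; apply/eqP; lra.
Qed.

Local Ltac pos := repeat first
  [ assumption | exact: sqr_ge0 | exact: ler0n | apply: ltW; assumption
  | apply: addr_ge0 | apply: mulr_ge0 ].

Lemma choi_min_ge0 x0 x1 x2 y0 y1 y2 :
  x0 ^+ 2 <= x1 ^+ 2 -> x0 ^+ 2 <= x2 ^+ 2 -> 0 <= choi x0 x1 x2 y0 y1 y2.
Proof.
move=> x01 x02.
have [/and3P[/eqP-> /eqP-> /eqP->]|x_neq0] := boolP [&& x0 == 0, x1 == 0 & x2 == 0].
  by rewrite /choi; lra.
have a0 : 0 < weight x0 x1 x2 by exact: weight_gt0.
have a1 : 0 < weight x1 x2 x0 by apply: weight_gt0; rewrite andbA andbC.
have a2 : 0 < weight x2 x0 x1 by apply: weight_gt0; rewrite andbC -andbA.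
rewrite -(pmulr_rge0 _ (mulr_gt0 (mulr_gt0 a0 a1) a2)) choi_lagrange.
have g0 := gap_ge0 (sqr_ge0 x0) x01 x02.
by pos.
Qed.

(** The two alternatives are the two rays on which the cubic vanishes.  The
    equations on the [y_i] are those of the vanishing minors, simplified by the
    ratios of the weights on each ray: 1 : 1 : 1 on the first, and
    65 : 26 : 104 on the second. *)
Lemma choi_min_eq0 x0 x1 x2 y0 y1 y2 :
    x0 ^+ 2 <= x1 ^+ 2 -> x0 ^+ 2 <= x2 ^+ 2 ->
    ~~ [&& x0 == 0, x1 == 0 & x2 == 0] ->
    ~~ [&& y0 == 0, y1 == 0 & y2 == 0] ->
    choi x0 x1 x2 y0 y1 y2 = 0 ->
  [/\ x1 ^+ 2 = x0 ^+ 2, x2 ^+ 2 = x0 ^+ 2, y1 * x0 = y0 * x1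
    & y2 * x0 = y0 * x2] \/
  [/\ x0 = 0, y0 = 0, x2 ^+ 2 = (2 * x1) ^+ 2 & y1 * x2 = 4 * y2 * x1].
Proof.
move=> x01 x02 x_neq0 y_neq0 c0.
have a0 : 0 < weight x0 x1 x2 by exact: weight_gt0.
have a1 : 0 < weight x1 x2 x0 by apply: weight_gt0; rewrite andbA andbC.
have a2 : 0 < weight x2 x0 x1 by apply: weight_gt0; rewrite andbC -andbA.
have g_ge0 := gap_ge0 (sqr_ge0 x0) x01 x02.
have := choi_lagrange x0 x1 x2 y0 y1 y2; rewrite /= c0 mulr0 => /esym/eqP.
have s_gt0 : 0 < weight x0 x1 x2 * y0 ^+ 2 + weight x1 x2 x0 * y1 ^+ 2
    + weight x2 x0 x1 * y2 ^+ 2.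
  rewrite lt_neqAle eq_sym; apply/andP; split; last by pos.
  apply: contraNneq y_neq0 => /eqP.
  rewrite !paddr_eq0; try by pos.
  rewrite !mulf_eq0 !(gt_eqF a0, gt_eqF a1, gt_eqF a2) !orbb.
  by rewrite -andbA.
rewrite paddr_eq0; try by pos.
rewrite !mulf_eq0 (gt_eqF s_gt0) !pnatr_eq0 /= orbF => /andP[/eqP g0].
rewrite !paddr_eq0; try by pos.
rewrite !mulf_eq0 !(gt_eqF a0, gt_eqF a1, gt_eqF a2) !orbb !subr_eq0.
move=> /andP[/andP[/eqP m01 /eqP m12] /eqP m20].
have [[x10 x20]|[x00 x21]] := gap_eq0 (sqr_ge0 x0) x01 x02 g0.
  have x0s : x0 ^+ 2 != 0.
    apply: contraNneq x_neq0 => x0s.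
    by rewrite -(sqrf_eq0 x0) -(sqrf_eq0 x1) -(sqrf_eq0 x2) x10 x20 x0s eqxx.
  left; split=> //; apply: (mulfI x0s).
  - by move: m01; rewrite /weight x10 x20; lra.
  - by move: m20; rewrite /weight x10 x20; lra.
right.
have x0E : x0 = 0 by apply/eqP; rewrite -sqrf_eq0; apply/eqP.
have x1_neq0 : x1 != 0.
  apply: contraNneq x_neq0 => z; rewrite x0E z eqxx /=.
  by move/eqP: x21; rewrite z expr0n mulr0 expf_eq0.
split=> //.
- move: m01; rewrite [in RHS]x0E mulr0 => /eqP.
  by rewrite !mulf_eq0 (gt_eqF a0) (negPf x1_neq0) orbF => /eqP ->.
- by rewrite x21; lra.
- have x1s : x1 ^+ 2 != 0 by rewrite sqrf_eq0.
  apply: (mulfI x1s).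
  move: m12; rewrite /weight x0E x21; lra.
Qed.

End Choi.

(** * The form as a biquadratic polynomial *)

Section Bihomogeneous.
Variable S : comNzRingType.
Implicit Types p q : {mpoly S[3 + 3]}.

(** Bidegrees other than (2, 2) let the biquadratic property be derived factor
    by factor. *)
Definition bihom a b p := forall m, m \in msupp p -> xdeg m = a /\ ydeg m = b.

Lemma bihomD a b p q : bihom a b p -> bihom a b q -> bihom a b (p + q).
Proof.
by move=> hp hq m /msuppD_le; rewrite mem_cat => /orP[/hp|/hq].
Qed.

Lemma bihomN a b p : bihom a b p -> bihom a b (- p).
Proof. by move=> hp m; rewrite (perm_mem (msuppN p)) => /hp. Qed.

Lemma bihomM a b c d p q :
  bihom a b p -> bihom c d q -> bihom (a + c) (b + d) (p * q).
Proof.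
move=> hp hq m /msuppM_le/allpairsP[[m1 m2]]/= [/hp[<- <-] /hq[<- <-] ->].
by split; rewrite -big_split; apply: eq_bigr => i _; rewrite mnmDE.
Qed.

Lemma bihomX a b p n : bihom a b p -> bihom (n * a) (n * b) (p ^+ n).
Proof.
move=> hp; elim: n => [|n IHn]; last by rewrite exprS !mulSn; exact: bihomM.
move=> m; rewrite expr0 msupp1 inE => /eqP ->.
by split; apply: big1 => i _; rewrite mnm0E.
Qed.

Lemma bihom_nat n : bihom 0 0 (n%:R : {mpoly S[3 + 3]}).
Proof.
move=> m; rewrite -mpolyC_nat msuppC; case: eqP => // _.
by rewrite inE => /eqP ->; split; apply: big1 => i _; rewrite mnm0E.
Qed.

Lemma bihom_x i : bihom 1 0 ('X_(lshift 3 i) : {mpoly S[3 + 3]}).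
Proof.
move=> m; rewrite msuppX inE => /eqP ->; split.
  rewrite /xdeg (bigD1 i) //= mnm1E eqxx big1 // => j ji.
  by rewrite mnm1E eq_lshift eq_sym (negPf ji).
by apply: big1 => j _; rewrite mnm1E eq_lrshift.
Qed.

Lemma bihom_y i : bihom 0 1 ('X_(rshift 3 i) : {mpoly S[3 + 3]}).
Proof.
move=> m; rewrite msuppX inE => /eqP ->; split.
  by apply: big1 => j _; rewrite mnm1E eq_rlshift.
rewrite /ydeg (bigD1 i) //= mnm1E eqxx big1 // => j ji.
by rewrite mnm1E eq_rshift eq_sym (negPf ji).
Qed.

Local Notation X i := ('X_(lshift 3 i) : {mpoly S[3 + 3]}).
Local Notation Y j := ('X_(rshift 3 j) : {mpoly S[3 + 3]}).

Definition choi_form : {mpoly S[3 + 3]} :=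
  choi (X 0) (X 1) (X 2) (Y 0) (Y 1) (Y 2).

Lemma choi_form_biquadratic : biquadratic_form choi_form.
Proof.
have sq i k : bihom 2 2 (X i ^+ 2 * Y k ^+ 2) :=
  bihomM (bihomX (n := 2) (@bihom_x i)) (bihomX (n := 2) (@bihom_y k)).
have sqn n i k : bihom 2 2 (n%:R * X i ^+ 2 * Y k ^+ 2) :=
  bihomM (bihomM (@bihom_nat n) (bihomX (n := 2) (@bihom_x i)))
    (bihomX (n := 2) (@bihom_y k)).
have cross n i j k l : bihom 2 2 (n%:R * X i * X j * Y k * Y l) :=
  bihomM (bihomM (bihomM (bihomM (@bihom_nat n) (@bihom_x i)) (@bihom_x j))
    (@bihom_y k)) (@bihom_y l).
have row i j k := bihomD (bihomD (bihomD (@sqn 9 i i) (@sq j i)) (@sqn 16 k i))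
  (bihomN (@cross 26 i j i j)).
exact: (bihomD (bihomD (@row 0 1 2) (@row 1 2 0)) (@row 2 0 1)).
Qed.

Lemma bieval_choi_form (x y : 'rV[S]_3) :
  bieval choi_form x y =
  choi (x 0 0) (x 0 1) (x 0 2) (y 0 0) (y 0 1) (y 0 2).
Proof.
rewrite /bieval /choi_form (rmorph_choi (meval _)) /= !mevalXU.
by rewrite !row_mxEl !row_mxEr.
Qed.

End Bihomogeneous.

(** * Rotating the coordinates *)

Section Cyclic.
Implicit Types i j : 'I_3.

Lemma I3P (P : 'I_3 -> Prop) : P 0 -> P 1 -> P 2 -> forall i, P i.
Proof.
move=> P0 P1 P2 [[|[|[|//]]] ilt].
- by rewrite (_ : Ordinal ilt = 0) //; apply: val_inj.
- by rewrite (_ : Ordinal ilt = 1) //; apply: val_inj.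
- by rewrite (_ : Ordinal ilt = 2) //; apply: val_inj.
Qed.

Lemma I3_orbit i j : [\/ j = i, j = i + 1 | j = i + 2].
Proof.
move: i j; do 2!apply: I3P; by [constructor 1; exact: val_inj
  | constructor 2; exact: val_inj | constructor 3; exact: val_inj].
Qed.

Lemma I3_neq i : ((i + 1 == i) = false) * ((i + 2 == i) = false) *
  ((i + 2 == i + 1) = false).
Proof. by move: i; apply: I3P. Qed.

(** This allows the coordinate of least square to be taken first. *)
Lemma choi_cyc (S : comNzRingType) (x y : 'I_3 -> S) i :
  choi (x i) (x (i + 1)) (x (i + 2)) (y i) (y (i + 1)) (y (i + 2)) =
  choi (x 0) (x 1) (x 2) (y 0) (y 1) (y 2).
Proof.
have e : (1 + 1 = 2 :> 'I_3) * (1 + 2 = 0 :> 'I_3) * (2 + 1 = 0 :> 'I_3)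
    * (2 + 2 = 1 :> 'I_3) by do !split; exact: val_inj.
move: i; apply: I3P; rewrite ?add0r ?e //; first exact: choi_rot.
by rewrite choi_rot choi_rot.
Qed.

End Cyclic.

(** * The ten zeros *)

Section Zeros.
Variable R : realFieldType.
Implicit Types x y : 'rV[R]_3.

Lemma rV3_neq0 x i : (x != 0) =
  ~~ [&& x 0 i == 0, x 0 (i + 1) == 0 & x 0 (i + 2) == 0].
Proof.
congr (~~ _); apply/eqP/and3P => [->|[/eqP xi /eqP xi1 /eqP xi2]].
  by rewrite !mxE.
by apply/rowP => j; rewrite mxE; case: (I3_orbit i j) => ->.
Qed.

Lemma ex_min_sqr x : exists i, forall j, x 0 i ^+ 2 <= x 0 j ^+ 2.
Proof.
case: (@arg_minP _ _ _ 0 xpredT (fun i => x 0 i ^+ 2)) => // i _ imin.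
by exists i => j; exact: imin.
Qed.

(** The left summand indexes the points with all coordinates nonzero, by the
    signs of the last two; the right one indexes the points with a vanishing
    coordinate, by its position and a sign. *)
Definition zero_index : finType := ((bool * bool) + ('I_3 * bool))%type.

Definition zero_x (k : zero_index) : 'rV[R]_3 := \row_j
  match k with
  | inl (a, b) => if j == 0 then 1 else if j == 1 then (-1) ^+ a else (-1) ^+ b
  | inr (i, a) => if j == i then 0 else if j == i + 1 then 1 else (-1) ^+ a * 2
  end.

Definition zero_y (k : zero_index) : 'rV[R]_3 := \row_j
  match k with
  | inl (a, b) => if j == 0 then 1 else if j == 1 then (-1) ^+ a else (-1) ^+ b
  | inr (i, a) => if j == i then 0 else if j == i + 1 then (-1) ^+ a * 2 else 1
  end.

Lemma zero_x_neq0 k : zero_x k != 0.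
Proof.
case: k => [[a b]|[i a]]; apply/eqP => /rowP.
  by move/(_ 0); rewrite !mxE eqxx; apply/eqP; exact: oner_neq0.
by move/(_ (i + 1)); rewrite !mxE I3_neq eqxx; apply/eqP; exact: oner_neq0.
Qed.

Lemma zero_y_neq0 k : zero_y k != 0.
Proof.
case: k => [[a b]|[i a]]; apply/eqP => /rowP.
  by move/(_ 0); rewrite !mxE eqxx; apply/eqP; exact: oner_neq0.
by move/(_ (i + 2)); rewrite !mxE !I3_neq; apply/eqP; exact: oner_neq0.
Qed.

Lemma choi_form_ge0 x y : 0 <= bieval (choi_form R) x y.
Proof.
rewrite bieval_choi_form; have [i imin] := ex_min_sqr x.
by rewrite -(choi_cyc (x 0) (y 0) i) choi_min_ge0.
Qed.

Lemma choi_zero k : bieval (choi_form R) (zero_x k) (zero_y k) = 0.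
Proof.
rewrite bieval_choi_form; case: k => [[a b]|[i a]].
  rewrite !mxE /= /choi; case: a b => [] []; rewrite ?expr0 ?expr1; ring.
rewrite -(choi_cyc (zero_x _ 0) (zero_y _ 0) i) !mxE !I3_neq !eqxx /choi.
by case: a; rewrite ?expr0 ?expr1; ring.
Qed.

Lemma sqr_sign (u v : R) : u ^+ 2 = v ^+ 2 -> exists a : bool, u = (-1) ^+ a * v.
Proof.
move/eqP; rewrite eqf_sqr => /orP[/eqP ->|/eqP ->]; [exists false|exists true].
  by rewrite mul1r.
by rewrite mulN1r.
Qed.

(** An index [i] of least [x_i ^+ 2] decides the shape of the zero: if this
    minimum is nonzero then all squares are equal and [y] is proportional to
    [x]; otherwise [i] is the position of the vanishing coordinate. *)
Lemma choi_zero_inv x y : x != 0 -> y != 0 -> bieval (choi_form R) x y = 0 ->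
  exists k, (exists2 c, c != 0 & x = c *: zero_x k) /\
            (exists2 c, c != 0 & y = c *: zero_y k).
Proof.
move=> x_neq0 y_neq0; rewrite bieval_choi_form.
suff multiples k c d : x = c *: zero_x k -> y = d *: zero_y k ->
  exists k, (exists2 c, c != 0 & x = c *: zero_x k) /\
            (exists2 c, c != 0 & y = c *: zero_y k).
  have [i imin] := ex_min_sqr x; rewrite -(choi_cyc (x 0) (y 0) i).
  move: (x_neq0) (y_neq0); rewrite (rV3_neq0 x i) (rV3_neq0 y i) => x0 y0.
  case/choi_min_eq0 => // [[x1 x2 y1 y2]|[xi yi x12 y12]].
    have x_sqr j : x 0 j ^+ 2 = x 0 0 ^+ 2.
      suff h l : x 0 l ^+ 2 = x 0 i ^+ 2 by rewrite !h.
      by case: (I3_orbit i l) => ->.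
    have xi_neq0 : x 0 i != 0.
      apply: contraNneq x_neq0 => xi0; apply/eqP/rowP => j; rewrite mxE.
      by apply/eqP; rewrite -sqrf_eq0 x_sqr -(x_sqr i) xi0 expr0n.
    have [a x1E] := sqr_sign (x_sqr 1); have [b x2E] := sqr_sign (x_sqr 2).
    have xE : x = x 0 0 *: zero_x (inl (a, b)).
      by apply/rowP; apply: I3P; rewrite !mxE /= ?mulr1 // mulrC.
    apply: (multiples (inl (a, b)) (x 0 0) (y 0 i / x 0 i * x 0 0)) => //.
    rewrite -scalerA -[zero_y _]/(zero_x (inl (a, b))) -xE.
    apply/rowP => j; rewrite mxE.
    apply: (mulIf xi_neq0); rewrite mulrAC divfK //.
    by case: (I3_orbit i j) => ->.
  have x1_neq0 : x 0 (i + 1) != 0.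
    apply: contraNneq x0 => x10; rewrite xi x10 eqxx /=.
    by move/eqP: x12; rewrite x10 mulr0 expr0n sqrf_eq0.
  have [a x2E] := sqr_sign x12.
  apply: (multiples (inr (i, a)) (x 0 (i + 1)) (y 0 (i + 2))).
    apply/rowP => j; rewrite !mxE.
    by case: (I3_orbit i j) => ->; rewrite ?I3_neq ?eqxx ?mulr0 ?mulr1 // x2E; ring.
  apply/rowP => j; rewrite !mxE.
  case: (I3_orbit i j) => ->; rewrite ?I3_neq ?eqxx ?mulr0 ?mulr1 //.
  apply: (mulIf x1_neq0).
  move: y12; rewrite x2E; case: a {x2E} => /=; rewrite ?expr0 ?expr1; lra.
move=> xE yE; exists k; split; [exists c => //|exists d => //].
  by apply: contraNneq x_neq0 => c0; rewrite xE c0 scale0r.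
by apply: contraNneq y_neq0 => d0; rewrite yE d0 scale0r.
Qed.

(** Every [zero_x k] has an entry 1 at a place that depends only on the support,
    so proportional points share that entry and must be equal; the support
    and the signs then recover the index. *)
Lemma zero_x_inj k l c : zero_x k = c *: zero_x l -> k = l.
Proof.
have sign_inj (a b : bool) : (-1) ^+ a = (-1) ^+ b :> R -> a = b.
  by case: a; case: b => //=; rewrite ?expr0 ?expr1; lra.
have inl_neq0 a b j : zero_x (inl (a, b)) 0 j != 0.
  by move: j; apply: I3P; rewrite mxE /= ?signr_eq0 ?oner_eq0.
have inr_eq0 i a j : (zero_x (inr (i, a)) 0 j == 0) = (j == i).
  rewrite mxE; case: (I3_orbit i j) => ->; rewrite ?I3_neq ?eqxx ?oner_eq0 //.
  by rewrite mulf_eq0 signr_eq0 pnatr_eq0.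
move=> e; have {}e j : zero_x k 0 j = c * zero_x l 0 j.
  by rewrite e mxE.
case: k l e => [[a b]|[i a]] [[a' b']|[i' a']] e.
- have c1 : c = 1 by move: (e 0); rewrite !mxE /=; lra.
  move: (e 1) (e 2); rewrite c1 !mul1r !mxE /=.
  by move=> /sign_inj -> /sign_inj ->.
- have := inl_neq0 a b i'; rewrite e mulf_eq0 inr_eq0 eqxx orbT //.
- have c0 : c = 0.
    move/eqP: (e i); rewrite mxE eqxx eq_sym mulf_eq0.
    by rewrite (negPf (inl_neq0 _ _ _)) orbF => /eqP.
  have := inr_eq0 i a (i + 1); by rewrite e c0 mul0r eqxx I3_neq.
- have ii' : i' = i.
    by apply/eqP; rewrite -(inr_eq0 i a) e mulf_eq0 inr_eq0 eqxx orbT.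
  rewrite {}ii' in e *.
  have c1 : c = 1 by move: (e (i + 1)); rewrite !mxE I3_neq eqxx; lra.
  move: (e (i + 2)); rewrite c1 mul1r !mxE !I3_neq.
  by move=> /(mulIf (lt0r_neq0 (ltr0n _ 2)))/sign_inj ->.
Qed.

Definition zero_pt (k : zero_index) : proj_space R 2 * proj_space R 2 :=
  (proj_pt (zero_x_neq0 k), proj_pt (zero_y_neq0 k)).

Lemma zero_pt_inj : injective zero_pt.
Proof.
move=> k l /(congr1 fst)/proj_pt_eq[c _]; exact: zero_x_inj.
Qed.

Lemma bizeros_choi_form : bizeros (choi_form R) = range zero_pt.
Proof.
have hp : biquadratic_form (choi_form R) by exact: choi_form_biquadratic.
apply/seteqP; split=> [[L M]|_ [k _ <-]]; last first.
  exact/(bizeroE _ _ hp)/choi_zero.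
have [x [x0 ->]] := proj_ptP L; have [y [y0 ->]] := proj_ptP M.
move=> /(bizeroE x0 y0 hp)/(choi_zero_inv x0 y0)[k [xk yk]].
exists k => //; congr pair; apply/esym/proj_pt_eq; first exact: xk.
exact: yk.
Qed.

End Zeros.

Lemma card_range (I : finType) (T : Type) (f : I -> T) :
  injective f -> (range f #= `I_#|I|)%card.
Proof.
move=> f_inj; rewrite (card_eqr card_II).
have -> : range f = range (f \o enum_val : 'I_#|I| -> T).
  apply/seteqP; split=> _ [i _ <-]; last by exists (enum_val i).
  by exists (enum_rank i) => //=; rewrite enum_rankK.
by apply: inj_card_eq => i j _ _ /f_inj/enum_val_inj.
Qed.

Local Open Scope classical_set_scope.
Local Open Scope card_scope.

Theorem corollary5 (R : realType) :
  exists p : {mpoly R[3 + 3]},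
    [/\ biquadratic_form p, nonnegative_form p & bizeros p #= `I_10].
Proof.
exists (choi_form R); split; first exact: choi_form_biquadratic.
  exact: choi_form_ge0.
rewrite bizeros_choi_form.
have -> : 10%N = #|zero_index|.
  by rewrite card_sum !card_prod card_bool card_ord.
exact/card_range/zero_pt_inj.
Qed.
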